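(* Let $\sigma$ be a modal signature and let $M_a$ and $N_b$ be finite $\sigma$-LTSs. Then $M_a$ and $N_b$ satisfy exactly the same formulas of $\mathrm{ML}^G_\#$ over $\sigma$ if and only if $\hom_{\mathbb{N}}(\mathcal{F}_\sigma, M_a) = \hom_{\mathbb{N}}(\mathcal{F}_\sigma, N_b)$.
   Context: A modal signature is $\sigma = \mathrm{Prop} \cup \mathbb{A}$, where $\mathrm{Prop}$ is a finite set of unary relation symbols (proposition letters) and $\mathbb{A} = \{R_i \mid i \in I\}$ ($I$ finite) is a finite set of binary relation symbols (actions). A $\sigma$-LTS $M_a$ is a $\sigma$-structure $M$ with one distinguished element $a$. A homomorphism $h:T_c\to M_a$ is a map with $h(c)=a$ preserving all unary and binary facts. $\hom_{\mathbb{N}}(T_c,M_a)$ is the number of homomorphisms $T_c\to M_a$; for a class $\mathcal{C}$ of finite $\sigma$-LTSs, $\hom_{\mathbb{N}}(\mathcal{C},M_a)$ is the $\mathcal{C}$-indexed family of these numbers, and equality means agreement at every member. A directed $\sigma$-path from $m$ to $n$ is a sequence $m=b_0,\dots,b_\ell=n$ with $R(b_j,b_{j+1})$ for some $R\in\mathbb{A}$ for each $j<\ell$. A $\sigma$-tree is a $\sigma$-LTS in which every state is reached from the distinguished element by a unique directed $\sigma$-path. A $\sigma$-forest is the disjoint union of finitely many $\sigma$-trees, with distinguished element the root of one of them; $\mathcal{F}_\sigma$ is the class of finite $\sigma$-forests. $\mathrm{ML}^G_\#$ has formulas $\varphi ::= p\mid\varphi\land\varphi\mid\varphi\lor\varphi\mid\neg\varphi\mid\Diamond_i\varphi\mid\Box_i\varphi\mid\Diamond_i^{\geq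 n}\varphi\mid \mathrm{E}^{\geq n}\varphi$ ($n\geq 1$) with the usual clauses, where $M_a\models\Diamond_i^{\geq n}\varphi$ iff at least $n$ states $b$ with $R_i^M(a,b)$ satisfy $M_b\models\varphi$, and $M_a\models \mathrm{E}^{\geq n}\varphi$ iff at least $n$ states $b\in\mathrm{dom}(M)$ satisfy $M_b\models\varphi$.
   Formalization: Directed paths record the action used at each step, so tree edges carry exactly one action (with doubly labelled edges the claim fails), and the constant ⊤ is added to the formulas, since with Prop empty the grammar has no formulas and the claim fails. *)

(* Defs.v *)
From HB Require Import structures.
From mathcomp Require Import all_boot.

Set Implicit Arguments.
Unset Strict Implicit.
Unset Printing Implicit Defensive.

Record modal_sig := ModalSig { prop_sym : finType; act_sym : finType }.

(* Finite structures only. *)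
Record structure (sg : modal_sig) := Structure {
  state :> finType;
  holds : prop_sym sg -> pred state;
  trans : act_sym sg -> rel state
}.

Record lts (sg : modal_sig) := Lts { lstr :> structure sg; pt : lstr }.

Section Homomorphisms.

Variable sg : modal_sig.

Definition is_hom (T M : lts sg) (h : {ffun T -> M}) : bool :=
  [&& h (pt T) == pt M,
      [forall p, forall x, holds p x ==> holds p (h x)] &
      [forall i, forall x, forall y, trans i x y ==> trans i (h x) (h y)]].

Definition hom_count (T M : lts sg) : nat :=
  #|[set h : {ffun T -> M} | is_hom h]|.

Definition iso_lts (T U : lts sg) : Prop :=
  exists f : T -> U,
    [/\ bijective f, f (pt T) = pt U,
        forall p x, holds p (f x) = holds p x &
        forall i x y, trans i (f x) (f y) = trans i x y].

End Homomorphisms.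

Section Forests.

Variable sg : modal_sig.

(* A directed path records the action used at each step: two states related by
   two different actions are joined by two different paths. Hence consecutive
   states of a tree are related by exactly one action. *)
Fixpoint dpath (M : structure sg) (x : M) (s : seq (act_sym sg * M)) (y : M)
    : bool :=
  if s is (i, z) :: s' then trans i x z && dpath z s' y else x == y.

Definition is_tree (T : lts sg) : Prop :=
  forall x : T, exists! s, dpath (pt T) s x.

Definition dunion_str (n : nat) (Ts : 'I_n -> lts sg) : structure sg :=
  @Structure sg {k : 'I_n & Ts k}
    (fun p u => holds p (tagged u))
    (fun i u v => (tag u == tag v) && trans i (tagged u) (tagged_as u v)).

Definition dunion (n : nat) (Ts : 'I_n -> lts sg) (k : 'I_n) : lts sg :=
  @Lts sg (dunion_str Ts) (Tagged (fun j => Ts j : Type) (pt (Ts k))).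

Definition is_forest (F : lts sg) : Prop :=
  exists (n : nat) (Ts : 'I_n -> lts sg) (k : 'I_n),
    (forall j, is_tree (Ts j)) /\ iso_lts F (dunion Ts k).

End Forests.

(* FTop provides an atomic formula when there are no proposition letters; it is
   equivalent to p \/ ~ p for any letter p. *)
Inductive form (sg : modal_sig) : Type :=
| FTop
| FVar (p : prop_sym sg)
| FAnd (f g : form sg)
| FOr (f g : form sg)
| FNot (f : form sg)
| FDia (i : act_sym sg) (f : form sg)
| FBox (i : act_sym sg) (f : form sg)
| FDiaGe (i : act_sym sg) (n : nat) (n_gt0 : 0 < n) (f : form sg)
| FEGe (n : nat) (n_gt0 : 0 < n) (f : form sg).

Fixpoint sat (sg : modal_sig) (M : structure sg) (f : form sg) (x : M) : bool :=
  match f with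
  | FTop => true
  | FVar p => holds p x
  | FAnd g h => sat g x && sat h x
  | FOr g h => sat g x || sat h x
  | FNot g => ~~ sat g x
  | FDia i g => [exists y, trans i x y && sat g y]
  | FBox i g => [forall y, trans i x y ==> sat g y]
  | FDiaGe i n _ g => n <= #|[set y | trans i x y & sat g y]|
  | FEGe n _ g => n <= #|[set y : M | sat g y]|
  end.

(* Main.v *)
Require Import Defs.
From mathcomp Require Import all_boot ssralg ssrint.
From mathcomp Require Import ring boolp.

(* Both directions rest on one fact ([matching]). Let f_i be a family of
   numerical invariants of points, closed under products and containing 1. If
   the sums of every f_i over two finite sets agree, then interpolation shows
   that each joint level set of the f_i has as many points in one set as in the
   other, so there is an injection of one set into the other preserving all the
   f_i.

   From logic to homomorphisms, the f_i are the truth values of formulas: the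
   graded modalities give class-preserving injections between successor sets of
   equivalent states, and E^{>=n} one between the domains. A homomorphism from
   a forest to M is transported to N along the unique path from the root to
   each node, and the transport is injective.

   From homomorphisms to logic, the f_i are the numbers of homomorphisms from
   trees, and gluing trees at the root multiplies them. Their sums over the
   i-successors of x count homomorphisms from a tree prefixed by an i-edge;
   their sums over the domain count homomorphisms from that tree plus an
   isolated root. Hence states with equal tree counts satisfy the same
   formulas. *)

Set Implicit Arguments.
Unset Strict Implicit.
Unset Printing Implicit Defensive.

(** * Interpolation and matching of finite sets by multiplicative invariants *)

Section Matching.

Import GRing.Theory.
Local Open Scope ring_scope.

(** Closure under products keeps the weighted sums zero when [w] is multiplied by a polynomial in
    the [F i]. One that vanishes off the class of [z0] and is a nonzero constant on it leaves a
    multiple of the class sum. *)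
Lemma sum_class_eq0 (Z : finType) (I : Type) (F : I -> Z -> int) (w : Z -> int)
    (one : I) (mul : I -> I -> I) :
    (forall z, F one z = 1) -> (forall i j z, F (mul i j) z = F i z * F j z) ->
    (forall i, \sum_z w z * F i z = 0) ->
  forall z0, \sum_(z | `[< forall i, F i z = F i z0 >]) w z = 0.
Proof.
move=> F1 FM wF z0; pose c z := `[< forall i, F i z = F i z0 >].
have c0 : c z0 by apply/asboolP.
(* [phi] is the product of the factors [F i1 - F i1 z1], one for each [z1]
   outside the class of [z0], with [i1] separating [z1] from [z0]. *)
have [phi [wphi phi0 phic phiN]] : exists phi : Z -> int,
    [/\ forall i, \sum_z w z * phi z * F i z = 0, phi z0 != 0,
        forall z, c z -> phi z = phi z0 &
        {in enum Z, forall z, ~~ c z -> phi z = 0}].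
  elim: (enum Z) => [|z1 s [phi [wphi phi0 phic phiN]]].
    by exists (fun=> 1); split=> // i; under eq_bigr do rewrite mulr1.
  have [cz1|Ncz1] := boolP (c z1).
    exists phi; split=> // z; rewrite inE => /orP[/eqP->|/phiN//].
    by rewrite cz1.
  have [i1 Fi1] : exists i, F i z1 <> F i z0 by apply/existsNP/asboolPn.
  exists (fun z => phi z * (F i1 z - F i1 z1)); split.
  - move=> i.
    transitivity (\sum_z w z * phi z * F (mul i1 i) z
                  - F i1 z1 * \sum_z w z * phi z * F i z).
      rewrite mulr_sumr -sumrB; apply: eq_bigr => z _; rewrite FM; ring.
    by rewrite !wphi mulr0 subrr.
  - by rewrite mulf_neq0 // subr_eq0; apply/eqP => /esym.
  - by move=> z /[dup] /phic-> /asboolP->.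
  - move=> z; rewrite inE => /orP[/eqP->|zs Ncz]; first by rewrite subrr mulr0.
    by rewrite phiN // mul0r.
have phi_w : \sum_(z | ~~ c z) w z * phi z * F one z = 0.
  by apply: big1 => z /phiN ->; rewrite ?mem_enum // mulr0 mul0r.
have := wphi one; rewrite (bigID c) /= phi_w addr0.
under eq_bigr => z /phic -> do rewrite F1 mulr1.
by rewrite -mulr_suml => /eqP; rewrite mulf_eq0 (negPf phi0) orbF => /eqP.
Qed.

(** Signed counting on [X + Y]: points of [S] weigh 1, points of [S'] weigh -1, and the class of
    [inl x0] has total weight 0. *)
Lemma card_class_eq (I : Type) (X Y : finType) (f : I -> X -> nat)
    (g : I -> Y -> nat) (one : I) (mul : I -> I -> I)
    (S : pred X) (S' : pred Y) :
    (forall x, f one x = 1%N) -> (forall y, g one y = 1%N) ->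
    (forall i j x, f (mul i j) x = f i x * f j x)%N ->
    (forall i j y, g (mul i j) y = g i y * g j y)%N ->
    (forall i, \sum_(x | S x) f i x = \sum_(y | S' y) g i y)%N ->
  forall x0, #|[set x | S x & `[< forall i, f i x = f i x0 >]]| =
             #|[set y | S' y & `[< forall i, f i x0 = g i y >]]|.
Proof.
move=> f1 g1 fM gM fg x0.
pose F i (z : X + Y) : int :=
  match z with inl x => (f i x)%:R | inr y => (g i y)%:R end.
pose w (z : X + Y) : int :=
  match z with inl x => (S x)%:R | inr y => - (S' y)%:R end.
have FE i z : F i z = F i (inl x0) <->
    match z with inl x => f i x = f i x0 | inr y => f i x0 = g i y end.
  by case: z => z /=; rewrite !natz; split=> [[]|->].
have F1 z : F one z = 1 by case: z => z /=; rewrite ?f1 ?g1.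
have FM i j z : F (mul i j) z = F i z * F j z.
  by case: z => z /=; rewrite ?fM ?gM natrM.
have wF i : \sum_z w z * F i z = 0.
  rewrite big_sumType /=; apply/eqP; under [X in _ + X]eq_bigr do rewrite mulNr.
  rewrite sumrN subr_eq0.
  under eq_bigr do rewrite -natrM mulnbl.
  under [eqbRHS]eq_bigr do rewrite -natrM mulnbl.
  by rewrite -!natr_sum -!big_mkcond fg.
have := sum_class_eq0 F1 FM wF (inl x0); rewrite big_sumType sumrN /= => /eqP.
rewrite subr_eq0 -!natr_sum !natz => /eqP[].
rewrite -!sum1dep_card.
have eqS (T : finType) (P : pred T) (c c' : T -> Prop) :
    (forall x, c x <-> c' x) ->
  (\sum_(x | `[< c x >]) P x = \sum_(x | P x && `[< c' x >]) 1)%N.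
  move=> cc'; rewrite [RHS]big_mkcondl.
  by apply: eq_big => [x|x _]; [exact: asbool_equiv_eq|case: (P x)].
rewrite (eqS _ S _ (fun x => forall i, f i x = f i x0)); last first.
  by move=> x; split=> H i; apply/(FE i (inl x)); exact: H.
rewrite (eqS _ S' _ (fun y => forall i, f i x0 = g i y)) // => y.
by split=> H i; apply/(FE i (inr y)); exact: H.
Qed.

End Matching.

Lemma matching (I : Type) (X Y : finType) (f : I -> X -> nat)
    (g : I -> Y -> nat) (one : I) (mul : I -> I -> I)
    (S : pred X) (S' : pred Y) (y0 : Y) :
    (forall x, f one x = 1) -> (forall y, g one y = 1) ->
    (forall i j x, f (mul i j) x = f i x * f j x) ->
    (forall i j y, g (mul i j) y = g i y * g j y) ->
    (forall i, \sum_(x | S x) f i x = \sum_(y | S' y) g i y) ->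
  exists b : X -> Y,
    (forall x, S x -> S' (b x) /\ forall i, f i x = g i (b x)) /\
    {in S &, injective b}.
Proof.
move=> f1 g1 fM gM fg.
pose A x := enum [set x' | S x' & `[< forall i, f i x' = f i x >]].
pose B x := enum [set y | S' y & `[< forall i, f i x = g i y >]].
(* The k-th point of a class goes to the k-th point of the matching class. By [ltB] the default [y0]
   is never reached from [S]. *)
pose b x := nth y0 (B x) (index x (A x)).
have memA x : S x -> x \in A x.
  by move=> Sx; rewrite mem_enum inE Sx; apply/asboolP.
have ltB x : S x -> index x (A x) < size (B x).
  by move=> /memA; rewrite -index_mem -!cardE (card_class_eq f1 g1 fM gM fg).
have bP x : S x -> S' (b x) /\ forall i, f i x = g i (b x).
  move=> /ltB /(mem_nth y0); rewrite -/(b x) mem_enum inE.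
  by move=> /andP[? /asboolP].
exists b; split=> // x1 x2 S1 S2 b12.
(* Equal images force equal invariants, hence the same two lists, and then equal positions in
   them. *)
have eqf i : f i x1 = f i x2.
  by rewrite (proj2 (bP _ S1)) (proj2 (bP _ S2)) b12.
have eA : A x1 = A x2.
  apply: (congr1 (fun D : {set X} => enum D)); apply/setP=> x; rewrite !inE.
  by congr (_ && _); apply: asbool_equiv_eq; split=> H i; rewrite H eqf.
have eB : B x1 = B x2.
  apply: (congr1 (fun D : {set Y} => enum D)); apply/setP=> y; rewrite !inE.
  by congr (_ && _); apply: asbool_equiv_eq; split=> H i; rewrite -H eqf.
move/eqP: b12; rewrite /b eB nth_uniq -?eB ?ltB ?enum_uniq //; last first.
  by rewrite eB ltB.
move=> /eqP e; rewrite -(nth_index x1 (memA _ S1)) e eA.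
by rewrite nth_index ?memA.
Qed.

(** * Homomorphism counts and their invariance under isomorphism *)

Section Homs.

Variable sg : modal_sig.
Implicit Types (T A B M N : lts sg).

Lemma is_homP T M (h : {ffun T -> M}) :
  reflect [/\ h (pt T) = pt M,
              forall p x, holds p x -> holds p (h x) &
              forall i x y, trans i x y -> trans i (h x) (h y)]
          (is_hom h).
Proof.
apply: (iffP and3P) => -[hp hl ht]; split.
- exact/eqP.
- by move=> p x; apply/implyP; move/forallP/(_ p)/forallP: hl.
- move=> i x y; apply/implyP.
  by move/forallP/(_ i)/forallP/(_ x)/forallP: ht.
- exact/eqP.
- by apply/forallP=> p; apply/forallP=> x; apply/implyP/hl.
- by apply/forallP=> i; apply/forallP=> x; apply/forallP=> y; apply/implyP/ht.
Qed.

Lemma hom_count_iso T A M : iso_lts T A -> hom_count T M = hom_count A M.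
Proof.
case=> f [[g fK gK] fpt fl ft]; rewrite /hom_count.
pose F (h : {ffun A -> M}) : {ffun T -> M} := [ffun x => h (f x)].
pose G (h : {ffun T -> M}) : {ffun A -> M} := [ffun x => h (g x)].
have FK : cancel F G by move=> h; apply/ffunP=> x; rewrite !ffunE gK.
have GK : cancel G F by move=> h; apply/ffunP=> x; rewrite !ffunE fK.
rewrite -(card_imset _ (can_inj FK)); apply: eq_card => h; rewrite inE.
rewrite -{2}(GK h) (mem_imset _ _ (can_inj FK)) inE.
apply/is_homP/is_homP=> -[hp hl ht]; split.
- by rewrite ffunE -fpt fK.
- by move=> p x; rewrite -{1}(gK x) fl ffunE => /hl.
- by move=> i x y; rewrite -{1}(gK x) -{1}(gK y) ft !ffunE => /ht.
- by rewrite -fpt ffunE fK in hp.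
- by move=> p x; rewrite -fl => /hl; rewrite ffunE fK.
- by move=> i x y; rewrite -ft => /ht; rewrite !ffunE !fK.
Qed.

Lemma dpath_rcons (S : structure sg) (x y z : S) s i :
  dpath x s y -> trans i y z -> dpath x (rcons s (i, z)) z.
Proof.
elim: s x => [|[j u] s IHs] x /=; first by move=> /eqP-> ->; rewrite eqxx.
by case/andP=> -> /IHs.
Qed.

(** * Transport of homomorphisms from [M] to [N] along the paths of a forest *)

Section Lift.

Variables (M N : lts sg) (E : M -> N -> Prop).
Variable b : act_sym sg -> M -> N -> M -> N.
Variable c : M -> N.

Hypothesis E_pt : E (pt M) (pt N).
Hypothesis E_holds : forall p x y, E x y -> holds p x = holds p y.
Hypothesis bP : forall i x y x', E x y -> trans i x x' ->
  trans i y (b i x y x') /\ E x' (b i x y x').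
Hypothesis b_inj : forall i x y, E x y -> {in trans i x &, injective (b i x y)}.
Hypothesis cP : forall x, E x (c x).
Hypothesis c_inj : injective c.

(* The image of the end of the path [s] from [u] under the lift of [h] that
   sends [u] to [y]. *)
Fixpoint carry (S : structure sg) (h : S -> M) (u : S) (y : N)
    (s : seq (act_sym sg * S)) : N :=
  if s is (i, v) :: s' then carry h v (b i (h u) y (h v)) s' else y.

Lemma carry_rcons (S : structure sg) (h : S -> M) u w v y s i :
    dpath u s w ->
  carry h u y (rcons s (i, v)) = b i (h w) (carry h u y s) (h v).
Proof.
elim: s u y => [|[j z] s IHs] u y /=; first by move=> /eqP->.
by case/andP=> _ /IHs.
Qed.

(** Carrying [y] along the unique path to each node is well defined, and an edge from [u] to [v]
    extends the path to [u] into the path to [v]. *)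
Lemma lift_exists T (h : T -> M) y : is_tree T ->
  exists h' : T -> N, h' (pt T) = y /\
    forall i u v, trans i u v -> h' v = b i (h u) (h' u) (h v).
Proof.
move=> treeT; have [r rP] := choice treeT.
have rE s x : dpath (pt T) s x -> r x = s by move/(proj2 (rP x)).
exists (fun x => carry h (pt T) y (r x)); split.
  by rewrite (rE [::]) //=.
move=> i u v uv; have ru := proj1 (rP u).
by rewrite (rE _ _ (dpath_rcons ru uv)) (carry_rcons _ _ _ _ ru).
Qed.

Lemma lift_related T (h : T -> M) (h' : T -> N) s u v :
    (forall i x y, trans i x y -> trans i (h x) (h y)) ->
    (forall i x y, trans i x y -> h' y = b i (h x) (h' x) (h y)) ->
  E (h u) (h' u) -> dpath u s v -> E (h v) (h' v).
Proof.
move=> ht h'E; elim: s u => [|[i z] s IHs] u Eu /=; first by move/eqP <-.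
case/andP=> uz; apply: IHs; rewrite (h'E _ _ _ uz).
by case: (bP Eu (ht _ _ _ uz)).
Qed.

(** A lift determines its source: once the parent's image in [M] is known, injectivity of [b]
    recovers the child's. *)
Lemma lift_inj T (h1 h2 : T -> M) (h' : T -> N) s u v :
    (forall i x y, trans i x y -> trans i (h1 x) (h1 y)) ->
    (forall i x y, trans i x y -> trans i (h2 x) (h2 y)) ->
    (forall i x y, trans i x y -> h' y = b i (h1 x) (h' x) (h1 y)) ->
    (forall i x y, trans i x y -> h' y = b i (h2 x) (h' x) (h2 y)) ->
  E (h1 u) (h' u) -> h1 u = h2 u -> dpath u s v -> h1 v = h2 v.
Proof.
move=> ht1 ht2 e1 e2; elim: s u => [|[i z] s IHs] u Eu eu /=.
  by move/eqP <-.
case/andP=> uz; have [_ Ez] := bP Eu (ht1 _ _ _ uz).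
apply: IHs; first by rewrite (e1 _ _ _ uz).
apply: (@b_inj i _ _ Eu).
- exact: (ht1 _ _ _ uz).
- by rewrite unfold_in eu; exact: (ht2 _ _ _ uz).
by rewrite -(e1 _ _ _ uz) [in RHS]eu -(e2 _ _ _ uz).
Qed.

Lemma dunion_hom_count_le n (Ts : 'I_n -> lts sg) k :
    (forall j, is_tree (Ts j)) ->
  hom_count (dunion Ts k) M <= hom_count (dunion Ts k) N.
Proof.
move=> treeTs; pose D := dunion Ts k.
pose r j : D := Tagged (fun j => Ts j : Type) (pt (Ts j)).
(* The distinguished root must go to [pt N]; the other roots are unconstrained and follow the
   injection [c] of the domains. *)
have lift (h : {ffun D -> M}) : exists h' : {ffun D -> N},
    (forall j, h' (r j) = if j == k then pt N else c (h (r j))) /\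
    forall i u v, trans i u v -> h' v = b i (h u) (h' u) (h v).
  have H j : exists h' : Ts j -> N,
      h' (pt (Ts j)) = (if j == k then pt N else c (h (r j))) /\
      forall i u v, trans i u v ->
        h' v = b i (h (Tagged (fun j => Ts j : Type) u)) (h' u)
                   (h (Tagged (fun j => Ts j : Type) v)).
    exact: (lift_exists (fun v => h (Tagged (fun j => Ts j : Type) v))).
  pose h' j := projT1 (cid (H j)).
  have h'P j := projT2 (cid (H j)).
  exists [ffun u : D => h' (tag u) (tagged u)]; split=> [j|i [ju u] [jv v]].
    by rewrite ffunE; case: (h'P j).
  rewrite !ffunE /= => /andP[/eqP/= ej]; case: jv / ej v => v.
  by rewrite tagged_asE; apply: (proj2 (h'P ju)).
have [L LP] := choice lift.
have tr_in i j (u v : Ts j) : trans i u v -> trans i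
   (Tagged (fun j => Ts j : Type) u : D) (Tagged (fun j => Ts j : Type) v : D).
  by move=> uv; rewrite /= eqxx tagged_asE.
have rE (h : {ffun D -> M}) : is_hom h -> forall j, E (h (r j)) (L h (r j)).
  move=> /is_homP[hp _ _] j; rewrite (proj1 (LP h)).
  by case: eqP => [->|_]; [rewrite hp|].
have LE (h : {ffun D -> M}) : is_hom h -> forall u, E (h u) (L h u).
  move=> hh [j u]; have [s [su _]] := treeTs j u.
  have /is_homP[_ _ ht] := hh.
  apply: (@lift_related (Ts j) (fun v => h (Tagged (fun j => Ts j : Type) v))
     (fun v => L h (Tagged (fun j => Ts j : Type) v)) s (pt (Ts j))) su.
  - by move=> i x y /tr_in /ht.
  - by move=> i x y /tr_in /(proj2 (LP h)).
  - exact: rE.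
rewrite /hom_count -(card_in_imset (f := L)); last first.
  move=> h1 h2; rewrite !inE => hh1 hh2 eL.
  have /is_homP[hp1 _ ht1] := hh1; have /is_homP[hp2 _ ht2] := hh2.
  apply/ffunP => -[j u]; have [s [su _]] := treeTs j u.
  apply: (@lift_inj (Ts j) (fun v => h1 (Tagged (fun j => Ts j : Type) v))
     (fun v => h2 (Tagged (fun j => Ts j : Type) v))
     (fun v => L h1 (Tagged (fun j => Ts j : Type) v)) s (pt (Ts j))) su.
  - by move=> i x y /tr_in /ht1.
  - by move=> i x y /tr_in /ht2.
  - by move=> i x y /tr_in /(proj2 (LP h1)).
  - by rewrite eL => i x y /tr_in /(proj2 (LP h2)).
  - exact: rE.
  - have := proj1 (LP h1) j; rewrite eL (proj1 (LP h2)).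
    case: eqP => [jk _|_ /c_inj //]; rewrite -/(r j) jk.
    exact: etrans hp1 (esym hp2).
apply: subset_leq_card; apply/subsetP=> g /imsetP[h]; rewrite !inE => hh ->{g}.
have /is_homP[hp hl ht] := hh; apply/is_homP; split.
- by rewrite (proj1 (LP h) k) eqxx.
- by move=> p x /hl; rewrite (E_holds _ (LE _ hh x)).
- move=> i x y xy; rewrite ((proj2 (LP h)) _ _ _ xy).
  by case: (bP (LE _ hh x) (ht _ _ _ xy)).
Qed.

End Lift.

(** * From equivalent formulas to homomorphism counts *)

Section Logic.

Variables M N : lts sg.
Hypothesis eqMN : forall f, sat f (pt M) = sat f (pt N).

(** Truth values are 0 or 1, so conjunction is their product and [FTop] is the unit required by
    [matching]. *)
Lemma sat_matching (S : pred M) (S' : pred N) :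
    (forall f, #|[set x | S x & sat f x]| = #|[set y | S' y & sat f y]|) ->
  exists b : M -> N,
    (forall x, S x -> S' (b x) /\ forall f, sat f x = sat f (b x)) /\
    {in S &, injective b}.
Proof.
move=> cardSS'.
have [||||| b [bP b_inj]] := @matching (form sg) M N (fun f x => sat f x)
  (fun f y => sat f y) (FTop sg) (@FAnd sg) S S' (pt N) => //.
- by move=> f g x /=; rewrite mulnb.
- by move=> f g x /=; rewrite mulnb.
- by move=> f; rewrite -!big_mkcondr !sum1dep_card.
exists b; split=> // x /bP[? H]; split=> // f.
by have := H f; do 2!case: sat.
Qed.

(** An inequality suffices, since the assumption on [M] and [N] is symmetric. *)
Lemma sat_eq_hom_count_le F : is_forest F -> hom_count F M <= hom_count F N.
Proof.
(* Graded modalities only express positive thresholds, and these determine a cardinality. *)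
have eqn m n : (forall k, 0 < k -> (k <= m) = (k <= n)) -> m = n.
  move=> H; apply/eqP; rewrite eqn_leq; case: m n H => [|m] [|n] H //=.
  - by have := H n.+1 isT; rewrite leqnn.
  - by have := H m.+1 isT; rewrite leqnn.
  - by rewrite -H // leqnn H // leqnn.
have [c [cP c_inj]] : exists c : M -> N,
    (forall x, predT x -> predT (c x) /\ forall f, sat f x = sat f (c x)) /\
    {in predT &, injective c}.
  apply: sat_matching => f /=; apply: eqn => k k_gt0.
  exact: (eqMN (FEGe k_gt0 f)).
(* Stated for all triples so that [choice] yields one function; at inequivalent states any map will
   do, and [c] is taken. *)
have bex (ixy : act_sym sg * M * N) : exists b : M -> N,
    (forall f, sat f ixy.1.2 = sat f ixy.2) ->
    (forall x, trans ixy.1.1 ixy.1.2 x ->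
      trans ixy.1.1 ixy.2 (b x) /\ forall f, sat f x = sat f (b x)) /\
    {in trans ixy.1.1 ixy.1.2 &, injective b}.
  case: ixy => [[i x] y] /=.
  have [Exy|?] := pselect (forall f, sat f x = sat f y); last by exists c.
  have [f|b ?] := @sat_matching (trans i x) (trans i y); last by exists b.
  apply: eqn => k k_gt0; exact: (Exy (FDiaGe i k_gt0 f)).
have [b bP] := choice bex.
case=> n [Ts [k [treeTs isoF]]]; rewrite !(hom_count_iso _ isoF).
apply: (@dunion_hom_count_le M N (fun x y => forall f, sat f x = sat f y)
  (fun i x y => b (i, x, y)) c) => //.
- by move=> p x y /(_ (FVar p)).
- by move=> i x y x' /(bP (i, x, y))[/= H _] /H.
- by move=> i x y /(bP (i, x, y))[].
- by move=> x; case: (cP x isT).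
- by move=> x y; apply: c_inj.
Qed.

End Logic.

End Homs.

(** * Joining two structures by an edge between their roots, or disjointly *)

Section Join.

Variable sg : modal_sig.
Implicit Types (A B M : lts sg) (e : option (act_sym sg)).

(** The condition that [join e A B] puts on the images [x] and [y] of the two roots; [None] stands
    for the disjoint union. *)
Definition linked (S : structure sg) e (x y : S) : bool :=
  if e is Some i then trans i x y else true.

Definition join_str e A B : structure sg :=
  @Structure sg (A + B)%type
    (fun p z => match z with inl a => holds p a | inr b => holds p b end)
    (fun i z z' => match z, z' with
                   | inl a, inl a' => trans i a a'
                   | inr b, inr b' => trans i b b'
                   | inl a, inr b => [&& e == Some i, a == pt A & b == pt B]
                   | inr _, inl _ => false
                   end).

Definition join e A B : lts sg := @Lts sg (join_str e A B) (inl (pt A)).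

Lemma hom_count_rooted e B M :
  \sum_(y | linked e (pt M) y) hom_count B (Lts y) =
  #|[set h : {ffun B -> M} | linked e (pt M) (h (pt B)) &
      is_hom (M := Lts (h (pt B))) h]|.
Proof.
rewrite -sum1dep_card (partition_big (fun h : {ffun B -> M} => h (pt B))
  (linked e (pt M))) /=; last by move=> h /andP[].
apply: eq_bigr => y ly; rewrite /hom_count -sum1dep_card.
apply: eq_bigl => h; apply/idP/idP => [hh|].
  have /is_homP[/= hy _ _] := hh.
  by rewrite hy ly eqxx andbT.
by case/andP=> /andP[_ hh] /eqP hy; rewrite hy in hh.
Qed.

(** A homomorphism from the join is a pair of homomorphisms, the second with its root image free up
    to the link. *)
Lemma hom_count_join e A B M :
  hom_count (join e A B) M =
  hom_count A M * \sum_(y | linked e (pt M) y) hom_count B (Lts y).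
Proof.
rewrite hom_count_rooted /hom_count -cardsX.
pose F (h : {ffun A -> M} * {ffun B -> M}) : {ffun join e A B -> M} :=
  [ffun z : A + B => match z with inl a => h.1 a | inr b => h.2 b end].
pose G (h : {ffun join e A B -> M}) : {ffun A -> M} * {ffun B -> M} :=
  ([ffun a => h (inl a)], [ffun b => h (inr b)]).
have FK : cancel F G.
  by case=> h1 h2; congr (_, _); apply/ffunP=> x; rewrite !ffunE.
have GK : cancel G F by move=> h; apply/ffunP=> -[x|x]; rewrite !ffunE.
rewrite -(card_imset _ (can_inj FK)); apply: eq_card => h.
rewrite -(GK h) (mem_imset _ _ (can_inj FK)); case: (G h) => h1 h2 {h}.
rewrite !inE /=; apply/is_homP/and3P => [[hp hl ht]|[]].
  split.
  - apply/is_homP; split.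
    + by have := hp; rewrite ffunE.
    + by move=> p x /(hl p (inl x)); rewrite ffunE.
    + by move=> i x y /(ht i (inl x) (inl y)); rewrite !ffunE.
  - case: e @F @G FK GK hp hl ht => [i|//] F G _ _ hp hl ht /=.
    have := ht i (inl (pt A)) (inr (pt B)); rewrite /= !eqxx => /(_ isT).
    by rewrite -hp !ffunE.
  - apply/is_homP; split=> //.
    + by move=> p x /(hl p (inr x)); rewrite ffunE.
    + by move=> i x y /(ht i (inr x) (inr y)); rewrite !ffunE.
move=> /is_homP[hp1 hl1 ht1] lk /is_homP[/= hp2 hl2 ht2]; split.
- by rewrite ffunE.
- by move=> p [x|x] /=; rewrite ffunE; [apply: hl1|apply: hl2].
- move=> i [x|x] [y|y] //=; rewrite !ffunE; first exact: ht1; last exact: ht2.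
  by case/and3P=> /eqP ee /eqP-> /eqP->; rewrite ee /= in lk; rewrite hp1.
Qed.

Lemma dpath_inr_inl e A B (x : B) (y : A) s :
  dpath (inr x : join e A B) s (inl y) = false.
Proof. by elim: s x => [|[i [z|z]] s IHs] x //=; rewrite IHs andbF. Qed.

Lemma dpath_join_inl e A B (x y : A) s :
  dpath (inl x : join e A B) s (inl y) ->
  exists2 s', s = [seq (u.1, inl u.2) | u <- s'] & dpath x s' y.
Proof.
elim: s x => [|[i [z|z]] s IHs] x /=.
- by move=> /eqP[->]; exists [::] => //=.
- case/andP=> xz /IHs[s' -> zy]; exists ((i, z) :: s') => //=.
  by rewrite xz.
- by rewrite dpath_inr_inl andbF.
Qed.

Lemma dpath_join_inr e A B (x y : B) s :
  dpath (inr x : join e A B) s (inr y) ->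
  exists2 s', s = [seq (u.1, inr u.2) | u <- s'] & dpath x s' y.
Proof.
elim: s x => [|[i [z|z]] s IHs] x //=.
- by move=> /eqP[->]; exists [::] => //=.
- case/andP=> xz /IHs[s' -> zy]; exists ((i, z) :: s') => //=.
  by rewrite xz.
Qed.

Lemma dpath_inl e A B (x y : A) s :
  dpath x s y ->
  dpath (inl x : join e A B) [seq (u.1, inl u.2) | u <- s] (inl y).
Proof.
elim: s x => [|[i z] s IHs] x /=; first by move/eqP->.
by case/andP=> -> /IHs.
Qed.

Lemma dpath_inr e A B (x y : B) s :
  dpath x s y ->
  dpath (inr x : join e A B) [seq (u.1, inr u.2) | u <- s] (inr y).
Proof.
elim: s x => [|[i z] s IHs] x /=; first by move/eqP->.
by case/andP=> -> /IHs.
Qed.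

(** No edge leads back to [A], so the path uses the added edge exactly once and splits there. *)
Lemma dpath_join_across e A B (x : A) (y : B) s :
  dpath (inl x : join e A B) s (inr y) ->
  exists i s1 s2, [/\ e = Some i,
    s = [seq (u.1, inl u.2) | u <- s1] ++
        (i, inr (pt B)) :: [seq (u.1, inr u.2) | u <- s2],
    dpath x s1 (pt A) & dpath (pt B) s2 y].
Proof.
elim: s x => [|[i [z|z]] s IHs] x //=.
- case/andP=> xz /IHs[j [s1 [s2 [-> -> p1 p2]]]].
  by exists j, ((i, z) :: s1), s2; split=> //=; rewrite xz.
- case/andP=> /and3P[/eqP-> /eqP-> /eqP->] /dpath_join_inr[s2 -> p2].
  by exists i, [::], s2; split=> //=.
Qed.

Lemma is_tree_join i A B :
  is_tree A -> is_tree B -> is_tree (join (Some i) A B).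
Proof.
move=> treeA treeB [x|x].
  have [s [sx s_uniq]] := treeA x.
  exists [seq (u.1, inl u.2) | u <- s]; split; first exact: dpath_inl.
  by move=> t /dpath_join_inl[t' -> /s_uniq ->].
have [s [sx s_uniq]] := treeB x.
exists ((i, inr (pt B)) :: [seq (u.1, inr u.2) | u <- s]); split.
  by rewrite /= !eqxx; apply: dpath_inr.
move=> t /dpath_join_across[j [s1 [s2 [[<-] -> p1 /s_uniq ->]]]].
(* [s1] runs from the root of [A] to itself, as the empty path does; uniqueness makes it empty. *)
have [s0 [_ s0_uniq]] := treeA (pt A).
by rewrite -(s0_uniq _ p1) (s0_uniq [::]) //=.
Qed.

Lemma is_forest_tree A : is_tree A -> is_forest A.
Proof.
move=> treeA; exists 1, (fun=> A), ord0; split=> //.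
exists (fun x => existT (fun=> A : Type) ord0 x : dunion (fun=> A) ord0).
split=> //.
- exists (fun u : {_ : 'I_1 & A} => tagged u) => // -[j x].
  by rewrite (ord1 j).
- move=> i x y /=.
  by rewrite (tagged_asE (u := existT (fun _ : 'I_1 => A : Type) ord0 x) y).
Qed.

Lemma is_forest_join A B : is_tree A -> is_tree B -> is_forest (join None A B).
Proof.
move=> treeA treeB; pose Ts (j : 'I_2) := if val j is 0 then A else B.
exists 2, Ts, ord0; split; first by case=> -[|].
pose f (z : join None A B) : dunion Ts ord0 := match z with
  | inl a => existT (fun j => Ts j : Type) ord0 a
  | inr b => existT (fun j => Ts j : Type) ord_max b end.
pose g (u : dunion Ts ord0) : join None A B :=
  let: existT j x := u in
  (* The type of [x] depends on the value of [j], hence the dependent match. *)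
  (if val j is 0 as m return (if m is 0 then A else B : Type) -> A + B
   then inl else inr) x.
exists f; split=> //.
- exists g; first by case.
  case=> -[[|[|//]] lt].
    by rewrite (bool_irrelevance lt (ltn0Sn 1)).
  by rewrite (bool_irrelevance lt (ltnSn 1)).
- by move=> p [].
- move=> i [x|x] [y|y] //=.
  + by rewrite (tagged_asE (u := existT (fun j => Ts j : Type) ord0 x) y).
  + by rewrite (tagged_asE (u := existT (fun j => Ts j : Type) ord_max x) y).
Qed.

End Join.

(** * Terms for trees, and from tree counts to formulas *)

Section TreeTerms.

Variable sg : modal_sig.

(* [Att i t u] is [t] with [u] attached below its root by an [i]-edge; every
   finite tree arises in this way. *)
Inductive tterm : Type :=
| Pt (P : {set prop_sym sg})
| Att (i : act_sym sg) (t u : tterm).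

Definition point (P : {set prop_sym sg}) : lts sg :=
  @Lts sg (@Structure sg unit (fun p _ => p \in P) (fun _ _ _ => false)) tt.

Fixpoint tree_of (t : tterm) : lts sg :=
  match t with
  | Pt P => point P
  | Att i t u => join (Some i) (tree_of t) (tree_of u)
  end.

(** The number of homomorphisms from [tree_of t] that send the root to [x], in recursive form; see
    [hom_count_tree_of]. *)
Fixpoint thom (S : structure sg) (t : tterm) (x : S) : nat :=
  match t with
  | Pt P => [forall p in P, holds p x]
  | Att i t u => thom t x * \sum_(y | trans i x y) thom u y
  end.

Lemma is_tree_point P : is_tree (point P).
Proof. by case; exists [::]; split=> // -[|[]]. Qed.

Lemma is_tree_tree_of t : is_tree (tree_of t).
Proof.
elim: t => [P|i t IHt u IHu] /=; [exact: is_tree_point|exact: is_tree_join].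
Qed.

Lemma hom_count_point P (M : lts sg) :
  hom_count (point P) M = [forall p in P, holds p (pt M)].
Proof.
pose h0 : {ffun point P -> M} := [ffun=> pt M].
have h0_uniq (h : {ffun point P -> M}) : is_hom h -> h = h0.
  by case/is_homP=> hp _ _; apply/ffunP=> -[]; rewrite ffunE.
have h0E : is_hom h0 = [forall p in P, holds p (pt M)].
  apply/is_homP/forall_inP => [[_ hl _] p pP|hl].
    by have := hl p tt pP; rewrite ffunE.
  by split=> //; [rewrite ffunE|move=> p x /hl; rewrite ffunE].
rewrite /hom_count -h0E; have [hh|Nh] := boolP (is_hom h0).
  rewrite (_ : [set h | _] = [set h0]) ?cards1 //; apply/setP=> h; rewrite !inE.
  by apply/idP/eqP => [/h0_uniq|->].
rewrite (_ : [set h | _] = set0) ?cards0 //; apply/setP=> h; rewrite !inE.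
by apply: contraNF Nh => hh; rewrite -(h0_uniq _ hh).
Qed.

Lemma hom_count_tree_of t (M : lts sg) :
  hom_count (tree_of t) M = thom t (pt M).
Proof.
elim: t M => [P|i t IHt u IHu] M /=; first exact: hom_count_point.
rewrite hom_count_join IHt; congr (_ * _).
by apply: eq_bigr => y _; rewrite IHu.
Qed.

(** The leftmost [Pt] carries the labels of the root, so only the root gains [P]. *)
Fixpoint add_props (P : {set prop_sym sg}) (t : tterm) : tterm :=
  match t with
  | Pt Q => Pt (P :|: Q)
  | Att i t u => Att i (add_props P t) u
  end.

(** Identification of the two roots, the product under which [thom] is multiplicative. *)
Fixpoint glue (t t' : tterm) : tterm :=
  match t with
  | Pt P => add_props P t'
  | Att i t u => Att i (glue t t') u
  end.

Lemma thom_top (S : structure sg) (x : S) : thom (Pt set0) x = 1.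
Proof.
rewrite /= (_ : [forall _ in _, _]) //.
by apply/forall_inP=> p; rewrite inE.
Qed.

Lemma thom_glue (S : structure sg) t t' (x : S) :
  thom (glue t t') x = thom t x * thom t' x.
Proof.
elim: t => [P|i t IHt u _] /=; last by rewrite IHt mulnAC.
elim: t' => [Q|i t IHt u _] /=; last by rewrite IHt mulnA.
rewrite mulnb; congr (nat_of_bool _); apply/forall_inP/andP.
  by move=> H; split; apply/forall_inP=> p pP; apply: H; rewrite inE pP ?orbT.
by case=> /forall_inP HP /forall_inP HQ p; rewrite inE => /orP[/HP|/HQ].
Qed.

Lemma thom_card_le (S S' : structure sg) (D : pred S) (D' : pred S')
    (q : pred S) (q' : pred S') (y0 : S') :
    (forall t, \sum_(x | D x) thom t x = \sum_(y | D' y) thom t y) ->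
    (forall x y, (forall t, thom t x = thom t y) -> q x = q' y) ->
  #|[set x | D x & q x]| <= #|[set y | D' y & q' y]|.
Proof.
move=> DD' qq'.
have [b [bP b_inj]] := matching y0 (@thom_top S) (@thom_top S')
  (@thom_glue S) (@thom_glue S') DD'.
rewrite -(card_in_imset (f := b)); last first.
  by move=> x y; rewrite !inE => /andP[Dx _] /andP[Dy _]; apply: b_inj.
apply: subset_leq_card; apply/subsetP=> y /imsetP[x]; rewrite inE.
move=> /andP[/bP[Dbx xb] qx] ->{y}.
by rewrite inE Dbx -(qq' _ _ xb).
Qed.

Lemma thom_card_eq (S S' : structure sg) (D : pred S) (D' : pred S')
    (q : pred S) (q' : pred S') (x0 : S) (y0 : S') :
    (forall t, \sum_(x | D x) thom t x = \sum_(y | D' y) thom t y) ->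
    (forall x y, (forall t, thom t x = thom t y) -> q x = q' y) ->
  #|[set x | D x & q x]| = #|[set y | D' y & q' y]|.
Proof.
move=> DD' qq'; apply/eqP; rewrite eqn_leq (thom_card_le y0 DD' qq') /=.
by apply: (thom_card_le x0) => // y x yx; apply/esym/qq' => t; rewrite yx.
Qed.

(** By induction on [f]: the induction hypothesis says that truth depends only on tree counts, so
    [thom_card_eq] equates the numbers of satisfying points. *)
Lemma thom_eq_sat (S S' : structure sg) (f : form sg) (x : S) (y : S') :
    (forall t, \sum_(z : S) thom t z = \sum_(z : S') thom t z) ->
  (forall t, thom t x = thom t y) -> sat f x = sat f y.
Proof.
move=> SS'.
have thom_sum i (u : S) (v : S') t : (forall t, thom t u = thom t v) ->
    \sum_(z | trans i u z) thom t z = \sum_(z | trans i v z) thom t z.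
  (* With a bare root above an [i]-edge to [t], the count is the sum over successors. *)
  move/(_ (Att i (Pt set0) t)).
  by rewrite /= -!/(thom (Pt set0) _) !thom_top !mul1n.
elim: f x y => [|p|f IHf g IHg|f IHf g IHg|f IHf|i f IHf|i f IHf|i n ? f IHf|
  n ? f IHf] x y xy //=.
- have := xy (Pt [set p]) => /=.
  have E (R : structure sg) (z : R) :
      [forall q in [set p], holds q z] = holds p z.
    apply/forall_inP/idP => [->//|pz q]; first by rewrite inE.
    by rewrite inE => /eqP->.
  by rewrite !E; do 2!case: holds.
- by rewrite (IHf _ _ xy) (IHg _ _ xy).
- by rewrite (IHf _ _ xy) (IHg _ _ xy).
- by rewrite (IHf _ _ xy).
- have E (R : structure sg) (z : R) : [exists w, trans i z w && sat f w] =
      (0 < #|[set w | trans i z w & sat f w]|).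
    rewrite card_gt0; apply/existsP/set0Pn => -[w].
      by exists w; rewrite inE.
    by rewrite inE; exists w.
  by rewrite !E (thom_card_eq x y (fun t => thom_sum i x y t xy) IHf).
(* A box is the absence of successors refuting [f], again a cardinality. *)
- have E (R : structure sg) (z : R) : [forall w, trans i z w ==> sat f w] =
      (#|[set w | trans i z w & ~~ sat f w]| == 0).
    rewrite cards_eq0; apply/forallP/eqP => [H|/setP H w].
      by apply/setP=> w; rewrite !inE; have := H w; case: trans => //= ->.
    by have := H w; rewrite !inE; case: trans; case: sat.
  rewrite !E (@thom_card_eq _ _ _ (trans i y) _ (fun w => ~~ sat f w) x y) //.
    by move=> t; apply: thom_sum.
  by move=> u v uv; rewrite (IHf _ _ uv).
- by rewrite (thom_card_eq x y (fun t => thom_sum i x y t xy) IHf).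
- by rewrite (@thom_card_eq _ _ predT predT _ (sat f) x y).
Qed.

End TreeTerms.

Theorem theorem4p18 (sg : modal_sig) (M N : lts sg) :
  (forall f : form sg, sat f (pt M) <-> sat f (pt N)) <->
  (forall F : lts sg, is_forest F -> hom_count F M = hom_count F N).
Proof.
split=> [eqMN F forestF | eqMN f].
  have eqb f : sat f (pt M) = sat f (pt N) by apply/idP/idP => /eqMN.
  by apply/eqP; rewrite eqn_leq !sat_eq_hom_count_le.
have homT t : thom t (pt M) = thom t (pt N).
  rewrite -!hom_count_tree_of; apply: eqMN.
  exact/is_forest_tree/is_tree_tree_of.
(* The isolated unlabelled root has exactly one image, leaving the root of [tree_of t] free to range
   over the domain. *)
have sumE t (K : lts sg) :
    \sum_(x : K) thom t x = hom_count (join None (point set0) (tree_of t)) K.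
  rewrite hom_count_join (hom_count_tree_of (Pt set0)) thom_top mul1n.
  by apply: eq_bigr => x _; rewrite hom_count_tree_of.
have sumT t : \sum_(x : M) thom t x = \sum_(y : N) thom t y.
  rewrite !sumE; apply: eqMN; apply: is_forest_join.
    exact: is_tree_point.
  exact: is_tree_tree_of.
by rewrite (thom_eq_sat f sumT homT).
Qed.
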